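(* Let $G=(V,E)$ be a graph with two independent sets $N_1,N_2\subseteq V$ and let $P=V\setminus(N_1\cup N_2)$. Then the following are equivalent: (i) $G=(P,N_1,N_2,E)$ is a partitioned $2$-probe block graph; (ii) every block $B$ of $G$ is a $(K_B,X_B,Y_B,Z_B)$-graph such that $N_1\cap V(B)=X_B\cup Z_B$ and $N_2\cap V(B)=Y_B\cup Z_B$; (iii) the enhanced graph $G^*$ of $G$ is a block graph.
   Context: Graphs are finite and simple. A block of a graph is a maximal connected subgraph without a cut-vertex; a block graph is a graph in which every block is a clique. Given $G=(V,E)$ with given independent sets $N_1,N_2$, $G$ is a partitioned $2$-probe block graph if there is a set $E'$ of pairs $\{x,y\}$ with $x,y\in N_1$ or $x,y\in N_2$ such that $(V,E\cup E')$ is a block graph. A diamond is $K_4$ minus one edge; $C_4$ is the $4$-cycle. The enhanced graph $G^*=(V,E^* )$ is obtained from $G$ by adding every edge $xy$ such that $x,y$ are both in $N_1$ or both in $N_2$ and $x,y$ are two vertices of some induced diamond or of some induced $C_4$ in $G$. A vertex is universal if it is adjacent to all other vertices. A graph $H$ is a $(K,X,Y,Z)$-graph if $V(H)$ can be partitioned into disjoint (possibly empty) sets $K,X,Y,Z$ such that $K$ is the set of all universal vertices of $H$, $X\cup Z$ and $Y\cup Z$ are independent sets, and every vertex of $X$ is adjacent to every vertex of $Y$.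
   Formalization: In a (K,X,Y,Z)-graph, K is here a set of universal vertices, not necessarily the set of all of them; with ''all'', (i)⇒(ii) fails for G=K2 with N1 one end and N2 empty, where K would be both vertices and X=Y=Z=∅. *)

(* Defs.v *)
From mathcomp Require Import all_boot.

Set Implicit Arguments.
Unset Strict Implicit.
Unset Printing Implicit Defensive.

(* A finite simple graph is a symmetric irreflexive relation on a finType. *)

Section Graphs.

Variables (T : finType) (e : rel T).
Implicit Types (B K X Y Z S N : {set T}) (x y v : T).

Definition independent S : Prop := {in S &, forall x y, ~~ e x y}.

Definition clique S : Prop := {in S &, forall x y, x != y -> e x y}.

Definition induced S : rel T := [rel x y | [&& x \in S, y \in S & e x y]].

Definition connected S : Prop :=
  S != set0 /\ {in S &, forall x y, connect (induced S) x y}.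

(* v separates two other vertices of its component in the subgraph on S. *)
Definition cut_vertex S v : Prop :=
  v \in S /\
  exists x y, [/\ x \in S :\ v, y \in S :\ v, connect (induced S) x y
                & ~~ connect (induced (S :\ v)) x y].

Definition connected_no_cut_vertex S : Prop :=
  connected S /\ forall v, ~ cut_vertex S v.

(* A block is given by its vertex set: adding edges between vertices of a     *)
(* connected subgraph without a cut-vertex keeps it so, hence a maximal such  *)
(* subgraph is induced.  Isolated vertices and bridges give blocks too.       *)
Definition block B : Prop :=
  connected_no_cut_vertex B /\
  forall S, B \subset S -> connected_no_cut_vertex S -> S = B.

Definition block_graph : Prop := forall B, block B -> clique B.

Definition universal B v : Prop :=
  v \in B /\ {in B, forall x, x != v -> e v x}.

(* K consists of universal vertices of the subgraph induced by B but need not *)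
(* contain all of them: when X, Y and Z are prescribed by the nonprobe sets,  *)
(* a nonprobe may be universal as well, e.g. an end of a bridge.              *)
Definition KXYZ_graph B K X Y Z : Prop :=
  [/\ K :|: X :|: Y :|: Z = B,
      pairwise (fun S1 S2 : {set T} => [disjoint S1 & S2]) [:: K; X; Y; Z],
      {in K, forall v, universal B v},
      independent (X :|: Z) /\ independent (Y :|: Z)
    & {in X & Y, forall x y, e x y}].

Definition induced_diamond S : bool :=
  [exists a, exists b, exists c, exists d,
    [&& S == [set a; b; c; d], uniq [:: a; b; c; d], ~~ e a b,
        e a c, e a d, e b c, e b d & e c d]].

Definition induced_C4 S : bool :=
  [exists a, exists b, exists c, exists d,
    [&& S == [set a; b; c; d], uniq [:: a; b; c; d],
        e a b, e b c, e c d, e d a, ~~ e a c & ~~ e b d]].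

Definition both_nonprobe N1 N2 : rel T :=
  [rel x y | (x \in N1) && (y \in N1) || (x \in N2) && (y \in N2)].

Definition enhanced N1 N2 : rel T :=
  [rel x y | e x y ||
    [&& x != y, both_nonprobe N1 N2 x y
      & [exists S : {set T}, [&& x \in S, y \in S
                               & induced_diamond S || induced_C4 S]]]].

End Graphs.

Definition partitioned_2probe_block_graph (T : finType) (e : rel T)
    (N1 N2 : {set T}) : Prop :=
  exists e' : rel T,
    [/\ symmetric e', irreflexive e',
        forall x y, e' x y -> both_nonprobe N1 N2 x y
      & block_graph (relU e e')].

(* Main.v *)
(** Call two vertices inseparable when they lie in the same component and no
    third vertex separates them.  Vertices of a connected set without
    cut-vertex are pairwise inseparable; conversely a maximal set [S] of
    pairwise inseparable vertices is a block, because every vertex [w] of a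
    simple path with both ends in [S] is inseparable from all of [S] (a
    deleted vertex leaves one of the two halves of the path at [w] intact).
    So a graph is a block graph iff distinct inseparable vertices are adjacent,
    and adding edges between inseparable vertices does not change
    inseparability.

    Condition (ii) says that nonadjacent vertices of a common block of [G] are
    both in [N1] or both in [N2]; (i) implies this, as a block of [G] lies in a
    block of the completed graph, which is a clique.  Under (ii), two such
    vertices have two common neighbours, hence are opposite in an induced
    diamond or [C4] and get joined in [G*].  As diamonds and 4-cycles lie inside
    blocks, [G*] has the same inseparable pairs as [G], so it is a block graph,
    and then its added edges witness (i). *)
Require Import Defs.
From mathcomp Require Import all_boot.

Set Implicit Arguments.
Unset Strict Implicit.
Unset Printing Implicit Defensive.

(** * Inseparable pairs under changes of the edge set *)

Section Inseparable.

Variable T : finType.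
Implicit Types (e f : rel T) (A B S : {set T}) (x y v : T).

Definition insep e x y : bool :=
  connect e x y &&
  [forall v, (v != x) && (v != y) ==> connect (induced e [set~ v]) x y].

Lemma insepP e x y :
  reflect (connect e x y /\
           forall v, v != x -> v != y -> connect (induced e [set~ v]) x y)
          (insep e x y).
Proof.
apply: (iffP andP) => -[exy].
  by move=> /forallP H; split=> // v vx vy; have := H v; rewrite vx vy.
move=> H; split=> //; apply/forallP => v; apply/implyP => /andP[]; exact: H.
Qed.

Lemma inducedE e S x y : induced e S x y = [&& x \in S, y \in S & e x y].
Proof. by []. Qed.

Lemma sub_induced e f S S' :
  subrel e f -> S \subset S' -> subrel (induced e S) (induced f S').
Proof.
by move=> ef /subsetP SS' x y /and3P[/SS' xS /SS' yS /ef fxy]; apply/and3P.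
Qed.

Lemma sub_connect_induced e f S S' :
  subrel e f -> S \subset S' ->
  subrel (connect (induced e S)) (connect (induced f S')).
Proof.
move=> ef SS'; apply: connect_sub => x y H; apply: connect1.
exact: sub_induced H.
Qed.

Lemma insep_refl e x : insep e x x.
Proof. by apply/insepP; split=> *; exact: connect0. Qed.

Lemma adj_insep e x y : e x y -> insep e x y.
Proof.
move=> exy; apply/insepP; split=> [|v vx vy]; first exact: connect1.
by apply: connect1; rewrite inducedE !inE eq_sym vx eq_sym vy.
Qed.

Lemma induced_sym e S : symmetric e -> symmetric (induced e S).
Proof. by move=> es x y; rewrite !inducedE es andbCA. Qed.

Lemma insep_sym e : symmetric e -> symmetric (insep e).
Proof.
move=> es; suff H x y : insep e x y -> insep e y x
  by move=> x y; apply/idP/idP; apply: H.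
case/insepP=> exy H; apply/insepP; split=> [|v vy vx].
  by rewrite sym_connect_sym.
by rewrite (sym_connect_sym (induced_sym _ es)) H.
Qed.

Lemma insep_subrel e f : subrel e f -> subrel (insep e) (insep f).
Proof.
move=> ef x y /insepP[exy H]; apply/insepP; split=> [|v vx vy].
  by apply: connect_sub exy => ? ? /ef; exact: connect1.
exact: sub_connect_induced ef (subxx _) _ _ (H v vx vy).
Qed.

(** A walk along [f] that avoids [v] becomes a walk along [e] that avoids [v]: neither end of any of
    its edges is [v], so [v] does not separate these ends in [e]. *)
Lemma insep_idem e f : subrel f (insep e) -> subrel (insep f) (insep e).
Proof.
move=> fe x y /insepP[fxy H]; apply/insepP; split=> [|v vx vy].
  by apply: connect_sub fxy => a b /fe/insepP[].
apply: connect_sub (H v vx vy) => a b /and3P[]; rewrite !inE => av bv /fe/insepP[_].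
by apply; rewrite eq_sym.
Qed.

Lemma no_cut_vertex_insep e S :
  connected_no_cut_vertex e S -> {in S &, forall x y, insep e x y}.
Proof.
move=> [[_ conS] ncut] x y xS yS; apply/insepP; split=> [|v vx vy].
  by apply: connect_sub (conS x y xS yS) => a b /and3P[_ _]; exact: connect1.
have [vS|vS] := boolP (v \in S); last first.
  apply: sub_connect_induced (conS x y xS yS) => //.
  by apply/subsetP => z zS; rewrite !inE; apply: contraNneq vS => <-.
apply: (@sub_connect_induced e e (S :\ v)) => //; first exact: subsetDr.
apply/negPn/negP => nc; apply: (ncut v); split=> //; exists x, y.
by rewrite !inE eq_sym vx eq_sym vy; split=> //; exact: conS.
Qed.

(** * Simple paths, and blocks as maximal inseparable sets *)

Lemma path_connect_induced e S x p :
  path e x p -> {subset x :: p <= S} -> connect (induced e S) x (last x p).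
Proof.
elim: p x => [|y p IHp] x /= => [_ _|/andP[exy yp] sub]; first exact: connect0.
apply: (connect_trans (y := y)); last first.
  by apply: IHp => // z zp; apply: sub; rewrite inE zp orbT.
by apply: connect1; rewrite inducedE exy !sub // !inE eqxx ?orbT.
Qed.

Lemma path_induced_subset e S x p : path (induced e S) x p -> {subset p <= S}.
Proof.
elim: p x => //= y p IHp x /andP[/and3P[_ yS _] /IHp pS] z.
by rewrite inE => /predU1P[->|/pS].
Qed.

Lemma simple_path_insep e x p w z :
  symmetric e -> path e x p -> uniq (x :: p) -> w \in x :: p ->
  insep e z x -> insep e z (last x p) -> insep e z w.
Proof.
move=> es xp up wp /insepP[zx Hx] /insepP[_ Hy]; apply/insepP; split.
  by apply: connect_trans zx _; exact: path_connect xp _ wp.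
case/splitPl: wp xp up Hy => p1 p2 last1.
rewrite cat_path last_cat last1 -cat_cons cat_uniq => /andP[path1 path2].
move=> /and3P[_ /hasPn dis _] Hy v vz vw.
have [v1|v1] := boolP (v \in x :: p1); last first.
  apply: (connect_trans (y := x)).
    by apply: Hx => //; apply: contraNneq v1 => ->; exact: mem_head.
  rewrite -last1; apply: path_connect_induced => // u u1.
  by rewrite !inE; apply: contraNneq v1 => <-.
(* The path is simple, so a vertex other than [w] on its first half misses the second; [z] then
   reaches [w] through the far end. *)
have v2 : v \notin w :: p2.
  by rewrite inE negb_or vw; apply/negP => /dis; rewrite v1.
apply: (connect_trans (y := last w p2)).
  by apply: Hy => //; apply: contraNneq v2 => ->; exact: mem_last.
rewrite (sym_connect_sym (induced_sym _ es)).
apply: path_connect_induced => // u u2.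
by rewrite !inE; apply: contraNneq v2 => <-.
Qed.

Lemma insep_set_block e S :
  symmetric e -> S != set0 -> {in S &, forall x y, insep e x y} ->
  exists2 B, block e B & S \subset B.
Proof.
move=> es S0 Sins.
pose P (A : {set T}) := [forall x in A, forall y in A, insep e x y].
have PP (A : {set T}) : reflect {in A &, forall x y, insep e x y} (P A).
  apply: (iffP forall_inP) => [H x y xA|H x xA]; first exact/forall_inP/H.
  by apply/forall_inP => y; exact: H.
have /maxset_exists[B /maxsetP[/PP Bins Bmax] SB] : P S by exact/PP.
(* Each vertex of such a path could be added to [B] with all pairs still inseparable, so by
   maximality it is already there. *)
have pathB x p : x \in B -> path e x p -> uniq (x :: p) -> last x p \in B ->
    {subset x :: p <= B}.
  move=> xB xp up yB w wp.
  have wB z : z \in B -> insep e z w.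
    by move=> zB; apply: simple_path_insep wp _ _ => //; exact: Bins.
  suff <- : w |: B = B by exact: setU11.
  apply: Bmax; last exact: subsetUr.
  apply/PP => a b /setU1P[->|aB] /setU1P[->|bB]; last exact: Bins.
  - exact: insep_refl.
  - by rewrite insep_sym //; exact: wB.
  - exact: wB.
(* A walk inside [A] shortens to a simple path, which cannot leave [B]. Below, [A] is the whole
   vertex set for connectedness and the complement of [v] for the absence of cut-vertices. *)
have connB (A : {set T}) x y : x \in A -> x \in B -> y \in B ->
    connect (induced e A) x y -> connect (induced e (B :&: A)) x y.
  move=> xA xB yB /connectP[p0 /shortenP[p Ap up _] yE].
  have ep : path e x p by apply: sub_path Ap => a b /and3P[].
  have pA : {subset x :: p <= A}.
    by move=> w /predU1P[->|/(path_induced_subset Ap)].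
  rewrite yE; apply: (path_connect_induced ep) => w wp.
  by apply/setIP; split; [apply: (pathB x p); rewrite -?yE | exact: pA].
exists B => //; split.
  split.
    split; first by apply: contraNneq S0 => B0; rewrite -subset0 -B0.
    move=> x y xB yB.
    have /insepP[exy _] := Bins x y xB yB.
    rewrite -[B]setIT; apply: connB => //.
    by apply: connect_sub exy => a b ab; apply: connect1; rewrite inducedE !inE.
  move=> v [vB [x [y [/setD1P[xv xB] /setD1P[yv yB] _ /negP[]]]]].
  have /insepP[_ H] := Bins x y xB yB.
  rewrite setDE; apply: connB => //; first by rewrite !inE.
  by apply: H; rewrite eq_sym.
move=> A BA /no_cut_vertex_insep Ains.
by apply: Bmax => //; exact/PP.
Qed.

Lemma insep_block e x y :
  symmetric e -> insep e x y -> exists B, [/\ block e B, x \in B & y \in B].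
Proof.
move=> es ixy; have [||B bB /subsetP sB] := @insep_set_block e [set x; y] es.
- by apply/set0Pn; exists x; rewrite set21.
- move=> a b /set2P[]-> /set2P[]-> //; try exact: insep_refl.
  by rewrite insep_sym.
- by exists B; split=> //; apply: sB; rewrite !inE eqxx ?orbT.
Qed.

Lemma block_graph_insep e x y :
  symmetric e -> block_graph e -> x != y -> insep e x y -> e x y.
Proof. by move=> es bg xy /(insep_block es)[B [/bg cB xB yB]]; exact: cB. Qed.

(** * Common neighbours and 4-cycles *)

Lemma common_nbrs_insep e x y a b :
  symmetric e -> e x a -> e x b -> e y a -> e y b -> a != b -> insep e x y.
Proof.
move=> es xa xb ya yb ab; apply/insepP.
have step c v : e x c -> e y c -> v != x -> v != y -> v != c ->
    connect (induced e [set~ v]) x y.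
  move=> xc yc vx vy vc; apply: (connect_trans (y := c)); apply: connect1.
    by rewrite inducedE !inE eq_sym vx eq_sym vc.
  by rewrite inducedE !inE eq_sym vc eq_sym vy es.
split=> [|v vx vy].
  by apply: (connect_trans (y := a)); apply: connect1; rewrite // es.
(* Deleting one vertex leaves at least one of the two common neighbours. *)
have [va|va] := eqVneq v a; last exact: (step a).
by apply: (step b) => //; rewrite va.
Qed.

(** Opposite corners have the other two as common neighbours. Chords are allowed, so diamonds are
    covered as well. *)
Lemma cycle4_insep e a b c d :
  symmetric e -> uniq [:: a; b; c; d] ->
  e a b -> e b c -> e c d -> e d a ->
  {in [set a; b; c; d] &, forall x y, insep e x y}.
Proof.
move=> es /and4P[]; rewrite !inE !negb_or.
move=> /and3P[nab nac nad] /andP[nbc nbd] ncd _ ab bc cd da.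
have iac : insep e a c by apply: (@common_nbrs_insep e a c b d) => //; rewrite es.
have ibd : insep e b d by apply: (@common_nbrs_insep e b d a c) => //; rewrite es.
move: ab bc cd da => /adj_insep ab /adj_insep bc /adj_insep cd /adj_insep da.
by move=> x y; rewrite !inE -!orbA => /or4P[]/eqP-> /or4P[]/eqP->;
  rewrite ?insep_refl // insep_sym.
Qed.

(** A path inside [B] starts with a neighbour [a] of [x], which is not [y]. Since [a] is not a
    cut-vertex, a path avoiding it starts with a second neighbour. *)
Lemma two_neighbours e B x y :
  irreflexive e -> connected_no_cut_vertex e B -> x \in B -> y \in B ->
  x != y -> ~~ e x y ->
  exists a b, [/\ a \in B, b \in B, a != b, e x a & e x b].
Proof.
move=> ei [[_ conB] ncut] xB yB xy nexy.
have step S : connect (induced e S) x y -> exists2 a, a \in S & e x a.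
  case/connectP=> -[_ yx|a p /= /andP[/and3P[_ aS xa] _] _].
    by rewrite yx eqxx in xy.
  by exists a.
have [a aB xa] := step B (conB x y xB yB).
have [|b] := step (B :\ a).
  apply/negPn/negP => nc; apply: (ncut a); split=> //; exists x, y.
  rewrite !inE xB yB !andbT; split=> //; last exact: conB.
    by apply: contraTneq xa => ->; rewrite ei.
  by apply: contraNneq nexy => ->.
by move=> /setD1P[ba bB] xb; exists a, b; rewrite eq_sym.
Qed.

End Inseparable.

(** * Nonprobe pairs and the enhanced graph *)

Section Nonprobes.

Variables (T : finType) (e : rel T) (N1 N2 : {set T}).
Hypotheses (e_sym : symmetric e) (e_irr : irreflexive e).
Hypotheses (N1_indep : independent e N1) (N2_indep : independent e N2).
Implicit Types (B : {set T}) (x y : T).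

Lemma both_nonprobeE x y :
  both_nonprobe N1 N2 x y = (x \in N1) && (y \in N1) || (x \in N2) && (y \in N2).
Proof. by []. Qed.

Lemma both_nonprobe_sym : symmetric (both_nonprobe N1 N2).
Proof. by move=> x y; rewrite !both_nonprobeE andbC [(x \in N2) && _]andbC. Qed.

Lemma both_nonprobe_nadj x y : both_nonprobe N1 N2 x y -> ~~ e x y.
Proof. by case/orP=> /andP[xN yN]; [exact: N1_indep | exact: N2_indep]. Qed.

Lemma enhanced_insep : subrel (enhanced e N1 N2) (insep e).
Proof.
move=> x y /orP[/adj_insep //|/and3P[_ _ /existsP[S /and3P[xS yS]]]].
case/orP; move=> /existsP[a /existsP[b /existsP[c /existsP[d]]]].
  case/and5P=> /eqP SE uS _ ac /and4P[ad bc bd _].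
  (* The missing edge of the diamond is [a b], so its outer 4-cycle visits the corners in the order
     [a], [c], [b], [d]. *)
  have := @cycle4_insep _ e a c b d e_sym; apply=> //; try by rewrite e_sym.
  - move: uS; rewrite /= !inE !negb_or [c == b]eq_sym.
    by case/and4P=> /and3P[-> -> ->] /andP[-> ->] ->.
  - by move: xS; rewrite SE !inE; do 3 case: eqP => //=.
  - by move: yS; rewrite SE !inE; do 3 case: eqP => //=.
case/and5P=> /eqP SE uS ab bc /and4P[cd da _ _].
by have := @cycle4_insep _ e a b c d e_sym; apply=> //; rewrite -SE.
Qed.

Lemma common_nbrs_enhanced x y a b :
  x != y -> both_nonprobe N1 N2 x y -> a != b ->
  e x a -> e x b -> e y a -> e y b -> enhanced e N1 N2 x y.
Proof.
move=> xy bxy ab xa xb ya yb; apply/orP; right; apply/and3P; split=> //.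
have nxy := both_nonprobe_nadj bxy.
have ne u w : e u w -> u != w.
  by move=> uw; apply: contraTneq uw => ->; rewrite e_irr.
apply/existsP; exists [set x; y; a; b]; rewrite !inE !eqxx orbT /=.
(* As [x] and [y] are nonadjacent, the edge [a b] decides between a diamond and the induced 4-cycle
   [x a y b]. *)
have [eab|neab] := boolP (e a b); apply/orP; [left|right].
  apply/existsP; exists x; apply/existsP; exists y.
  apply/existsP; exists a; apply/existsP; exists b.
  by rewrite eqxx /= !inE !negb_or xy ab !ne // nxy xa xb ya yb.
apply/existsP; exists x; apply/existsP; exists a.
apply/existsP; exists y; apply/existsP; exists b.
have [ay bx] : e a y /\ e b x by rewrite !(e_sym _ y, e_sym _ x).
rewrite /= !inE !negb_or xy ab !ne // nxy neab xa ay yb bx !andbT.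
apply/eqP/setP => z; rewrite !inE.
by do 3 case: eqP => //=.
Qed.

Lemma nadj_common_nbrs B x y :
  connected_no_cut_vertex e B ->
  {in B &, forall u w, u != w -> e u w || both_nonprobe N1 N2 u w} ->
  x \in B -> y \in B -> x != y -> both_nonprobe N1 N2 x y ->
  exists a b, [/\ a != b, e x a, e x b, e y a & e y b].
Proof.
move=> Bnc Bnp.
(* Take for [u] the vertex that lies in every nonprobe set containing [w]; then all neighbours of
   [u] in [B] are common. *)
have main u w : u \in B -> w \in B -> u != w -> both_nonprobe N1 N2 u w ->
    (w \in N1 -> u \in N1) -> (w \in N2 -> u \in N2) ->
    exists a b, [/\ a != b, e u a, e u b, e w a & e w b].
  move=> uB wB uw buw w1 w2; have nuw := both_nonprobe_nadj buw.
  have [a [b [aB bB ab ua ub]]] := two_neighbours e_irr Bnc uB wB uw nuw.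
  (* Otherwise [w] and [c] share a nonprobe set; it contains [u] too, so its independence
     contradicts the edge [u c]. *)
  have adj c : c \in B -> e u c -> e w c.
    move=> cB uc; have wc : w != c by apply: contraNneq nuw => ->.
    case/orP: (Bnp _ _ wB cB wc) => // bwc.
    suff /both_nonprobe_nadj : both_nonprobe N1 N2 u c by rewrite uc.
    by rewrite both_nonprobeE; case/orP: bwc => /andP[wN ->];
      [rewrite w1 | rewrite w2 // orbT].
  by exists a, b; rewrite !adj.
move=> xB yB xy bxy.
(* Two subsets of [{N1, N2}] with a common element are nested, so [x] or [y] can play the role of
   [u]. *)
have [xy12|] :=
  boolP (((y \in N1) ==> (x \in N1)) && ((y \in N2) ==> (x \in N2))).
  by case/andP: xy12 => /implyP y1 /implyP y2; exact: main.
move=> H; have [a [b [ab ya yb xa xb]]] :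
    exists a b, [/\ a != b, e y a, e y b, e x a & e x b].
  apply: main => //; rewrite 1?eq_sym 1?both_nonprobe_sym //.
    by move: H bxy; rewrite both_nonprobeE; do 4 case: (_ \in _).
  by move: H bxy; rewrite both_nonprobeE; do 4 case: (_ \in _).
by exists a, b.
Qed.

(** Reduces the partition in condition (ii) to a condition on pairs, the form in which it meets
    inseparability. *)
Lemma KXYZ_nonprobe B :
  (exists K X Y Z : {set T},
     [/\ KXYZ_graph e B K X Y Z, N1 :&: B = X :|: Z & N2 :&: B = Y :|: Z]) <->
  {in B &, forall x y, x != y -> e x y || both_nonprobe N1 N2 x y}.
Proof.
split=> [[K [X [Y [Z [[BE _ Kuniv _ XY] N1E N2E]]]]] x y xB yB xy|np].
  have memN1 z : z \in X :|: Z -> z \in N1 by rewrite -N1E => /setIP[].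
  have memN2 z : z \in Y :|: Z -> z \in N2 by rewrite -N2E => /setIP[].
  have XN1 z : z \in X -> z \in N1 by move=> zX; apply: memN1; rewrite inE zX.
  have YN2 z : z \in Y -> z \in N2 by move=> zY; apply: memN2; rewrite inE zY.
  have ZN1 z : z \in Z -> z \in N1 by move=> zZ; apply: memN1; rewrite inE zZ orbT.
  have ZN2 z : z \in Z -> z \in N2 by move=> zZ; apply: memN2; rewrite inE zZ orbT.
  have inB z : z \in B -> [\/ z \in K, z \in X, z \in Y | z \in Z].
    by rewrite -BE !inE -!orbA => /or4P.
  have KB z w : z \in K -> w \in B -> w != z -> e z w.
    by move=> zK; have [_] := Kuniv z zK; apply.
  rewrite both_nonprobeE; case: (inB x xB) => xS.
  - by rewrite KB // eq_sym.
  - case: (inB y yB) => yS; first by rewrite e_sym KB.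
    + by rewrite (XN1 x) // (XN1 y) // orbT.
    + by rewrite XY.
    + by rewrite (XN1 x) // (ZN1 y) // orbT.
  - case: (inB y yB) => yS; first by rewrite e_sym KB.
    + by rewrite e_sym XY.
    + by rewrite (YN2 x) // (YN2 y) // !orbT.
    + by rewrite (YN2 x) // (ZN2 y) // !orbT.
  - case: (inB y yB) => yS; first by rewrite e_sym KB.
    + by rewrite (ZN1 x) // (XN1 y) // orbT.
    + by rewrite (ZN2 x) // (YN2 y) // !orbT.
    + by rewrite (ZN1 x) // (ZN1 y) // orbT.
(* Disjointness and the two prescribed intersections force this choice. *)
exists (B :\: (N1 :|: N2)), (B :&: (N1 :\: N2)),
  (B :&: (N2 :\: N1)), (B :&: (N1 :&: N2)).
have N1E : N1 :&: B = B :&: (N1 :\: N2) :|: B :&: (N1 :&: N2).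
  by apply/setP => z; rewrite !inE; do 3 case: (_ \in _).
have N2E : N2 :&: B = B :&: (N2 :\: N1) :|: B :&: (N1 :&: N2).
  by apply/setP => z; rewrite !inE; do 3 case: (_ \in _).
split=> //; split.
- by apply/setP => z; rewrite !inE; do 3 case: (_ \in _).
- by rewrite /= -!setI_eq0 !andbT; do ?[apply/andP; split];
    apply/eqP/setP => z; rewrite !inE; do 3 case: (_ \in _).
- move=> v /setDP[vB]; rewrite inE negb_or => /andP[v1 v2]; split=> // x xB xv.
  by have := np v x vB xB;
    rewrite eq_sym xv both_nonprobeE (negPf v1) (negPf v2) orbF; apply.
- by rewrite -N1E -N2E; split=> x y /setIP[xN _] /setIP[yN _];
    [exact: N1_indep | exact: N2_indep].
- move=> x y /setIP[xB /setDP[x1 x2]] /setIP[yB /setDP[y2 y1]].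
  have xy : x != y by apply: contraNneq x2 => ->.
  by have := np x y xB yB xy;
    rewrite both_nonprobeE (negPf x2) (negPf y1) andbF /= orbF.
Qed.

End Nonprobes.

Theorem theorem5 (T : finType) (e : rel T) (N1 N2 : {set T})
    (e_sym : symmetric e) (e_irr : irreflexive e)
    (N1_indep : independent e N1) (N2_indep : independent e N2) :
  (partitioned_2probe_block_graph e N1 N2 <->
   forall B : {set T}, block e B ->
     exists K X Y Z : {set T},
       [/\ KXYZ_graph e B K X Y Z,
           N1 :&: B = X :|: Z & N2 :&: B = Y :|: Z]) /\
  (partitioned_2probe_block_graph e N1 N2 <->
   block_graph (enhanced e N1 N2)).
Proof.
have iii_i : block_graph (enhanced e N1 N2) -> partitioned_2probe_block_graph e N1 N2.
  (* With the second disjunct of [enhanced] as witness, the completed graph is [enhanced e N1 N2] by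
     conversion. *)
  move=> bg; exists (fun x y => [&& x != y, both_nonprobe N1 N2 x y
      & [exists S : {set T}, [&& x \in S, y \in S
                               & induced_diamond e S || induced_C4 e S]]]).
  split=> //.
  - move=> x y; rewrite eq_sym both_nonprobe_sym; congr [&& _, _ & _].
    by apply: eq_existsb => S; rewrite andbCA.
  - by move=> x; rewrite eqxx.
  - by move=> x y /and3P[].
have i_ii : partitioned_2probe_block_graph e N1 N2 ->
    forall B, block e B ->
    {in B &, forall x y, x != y -> e x y || both_nonprobe N1 N2 x y}.
  move=> [e' [e's _ e'N bg]] B [/no_cut_vertex_insep Bi _] x y xB yB xy.
  have fs : symmetric (relU e e') by move=> u v /=; rewrite e_sym e's.
  have /orP[->//|/e'N ->] : relU e e' x y; last by rewrite orbT.
  apply: (@block_graph_insep _ (relU e e')) => //.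
  apply: insep_subrel (Bi x y xB yB).
  by move=> u v /= ->.
have ii_iii : (forall B, block e B ->
    {in B &, forall x y, x != y -> e x y || both_nonprobe N1 N2 x y}) ->
    block_graph (enhanced e N1 N2).
  move=> np A [/no_cut_vertex_insep Ai _] x y xA yA xy.
  (* Brings a pair from a block of the enhanced graph back into a common block of [e], where the
     pair condition applies. *)
  have ixy : insep e x y by apply: insep_idem (Ai x y xA yA); exact: enhanced_insep.
  have [B [bB xB yB]] := insep_block e_sym ixy.
  have /orP[exy|bxy] := np B bB x y xB yB xy; first by rewrite /enhanced /= exy.
  have [Bnc _] := bB.
  have [a [b [ab xa xb ya yb]]] :=
    nadj_common_nbrs e_irr N1_indep N2_indep Bnc (np B bB) xB yB xy bxy.
  exact: common_nbrs_enhanced ab xa xb ya yb.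
have KXYZ B := KXYZ_nonprobe e_sym N1_indep N2_indep B.
split; split.
- by move=> /i_ii np B /np/KXYZ.
- by move=> H; apply/iii_i/ii_iii => B /H/KXYZ.
- by move/i_ii/ii_iii.
- exact: iii_i.
Qed.
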